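(* A recurrent real-valued Lévy process has a partial right inverse if and only if it has a full right inverse.
   Context: Let $X=(X_t,t\ge0)$ be a Lévy process with $X_0=0$. A (full) right inverse of $X$ is an increasing process $K=(K_x,x\ge0)$ such that $X_{K_x}=x$ for all $x\ge0$. A partial right inverse of $X$ is an increasing process $K=(K_x,0\le x<\xi_K)$ such that $X_{K_x}=x$ for all $0\le x<\xi_K$, for some (random) $\xi_K>0$. *)

(* Defs.v *)
From HB Require Import structures.
From mathcomp Require Import all_boot all_order all_algebra.
From mathcomp Require Import all_classical all_reals all_analysis.
From mathcomp Require Import measurable_realfun.
Set Implicit Arguments.
Unset Strict Implicit.
Unset Printing Implicit Defensive.
Import Order.TTheory GRing.Theory Num.Theory.
Import numFieldNormedType.Exports.
Local Open Scope classical_set_scope.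
Local Open Scope ring_scope.

(** MathComp-Analysis.  A process indexed by [[0, +oo[] is a function
    [R -> T -> R]; its values at negative indices are never constrained. *)

Definition cadlag (R : realType) (f : R -> R) : Prop :=
  (forall t : R, 0 <= t -> f s @[s --> t^'+] --> f t) /\
  (forall t : R, 0 < t -> cvg (f s @[s --> t^'-])).

Definition increment (T : Type) (R : realType) (X : R -> T -> R) (s t : R)
    : T -> R :=
  fun w => X t w - X s w.

Definition independent_increments d (T : measurableType d) (R : realType)
    (P : probability T R) (X : R -> T -> R) : Prop :=
  forall (n : nat) (t : nat -> R),
    0 <= t 0%N -> (forall i, t i <= t i.+1) ->
  forall B : nat -> set R, (forall i, measurable (B i)) ->
    P (\bigcap_(i < n) (increment X (t i) (t i.+1) @^-1` B i)) =
    (\prod_(i < n) P (increment X (t i) (t i.+1) @^-1` B i))%E.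

Definition stationary_increments d (T : measurableType d) (R : realType)
    (P : probability T R) (X : R -> T -> R) : Prop :=
  forall s t : R, 0 <= s -> 0 <= t ->
  forall B : set R, measurable B ->
    P (increment X s (s + t) @^-1` B) = P (increment X 0 t @^-1` B).

Record levy_process d (T : measurableType d) (R : realType)
    (P : probability T R) (X : R -> T -> R) : Prop := {
  levy_measurable : forall t : R, 0 <= t -> measurable_fun [set: T] (X t) ;
  levy_start : {ae P, forall w, X 0 w = 0} ;
  levy_independent : independent_increments P X ;
  levy_stationary : stationary_increments P X ;
  levy_cadlag : {ae P, forall w, cadlag (X ^~ w)} }.

Definition recurrent d (T : measurableType d) (R : realType)
    (P : probability T R) (X : R -> T -> R) : Prop :=
  {ae P, forall w, limf_einf (fun t => `|X t w|%:E) (pinfty_nbhs R) = 0%E}.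

(** [K] may be weakly increasing: the equation [X (K x w) w = x] makes it
    injective in [x].  No adaptedness is required of [K]. *)
Record full_right_inverse d (T : measurableType d) (R : realType)
    (P : probability T R) (X : R -> T -> R) (K : R -> T -> R) : Prop := {
  rinv_measurable : forall x : R, 0 <= x -> measurable_fun [set: T] (K x) ;
  rinv_ae : {ae P, forall w,
    [/\ forall x : R, 0 <= x -> 0 <= K x w,
        forall x y : R, 0 <= x -> x <= y -> K x w <= K y w &
        forall x : R, 0 <= x -> X (K x w) w = x]} }.

(** The lifetime [xi] may be infinite; [K x w] is meaningful only when
    [0 <= x < xi w]. *)
Record partial_right_inverse d (T : measurableType d) (R : realType)
    (P : probability T R) (X : R -> T -> R)
    (xi : T -> \bar R) (K : R -> T -> R) : Prop := {
  prinv_lifetime_measurable : measurable_fun [set: T] xi ;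
  prinv_lifetime_gt0 : {ae P, forall w, (0 < xi w)%E} ;
  prinv_measurable : forall x : R, 0 <= x ->
    measurable_fun [set w | (x%:E < xi w)%E] (K x) ;
  prinv_ae : {ae P, forall w,
    [/\ forall x : R, 0 <= x -> (x%:E < xi w)%E -> 0 <= K x w,
        forall x y : R, 0 <= x -> x <= y -> (y%:E < xi w)%E -> K x w <= K y w &
        forall x : R, 0 <= x -> (x%:E < xi w)%E -> X (K x w) w = x]} }.

(* Main.v *)
Require Import Defs.
From mathcomp Require Import all_boot all_order all_algebra.
From mathcomp Require Import all_classical all_reals all_analysis.
From mathcomp Require Import measurable_realfun.
From mathcomp Require Import ring lra.
Set Implicit Arguments.
Unset Strict Implicit.
Unset Printing Implicit Defensive.
Import Order.TTheory GRing.Theory Num.Theory.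
Import numFieldNormedType.Exports.
Local Open Scope classical_set_scope.
Local Open Scope ring_scope.

(** A path climbs [a, b] if it admits a nondecreasing family of times at which
    it takes, possibly as a left limit, the values of [a, b] in order.  Each
    time carries at most two values of a cadlag path, so a climb is strictly
    increasing in the level and its right-continuous version is a genuine right
    inverse.  By compactness a climb exists as soon as there are approximate
    climbs through finite level grids at dyadic times, which makes "climbs
    within [r, t]" an event of the past of [t].

    A partial inverse gives [p = P(climbs [0, 2c]) > 0] for some [c > 0].
    Recurrence together with the fact that all small levels are approached
    makes every real number a neighbourhood-recurrent point.  Let [D] be the
    event that [z, z + c] is never climbed after time [r].  By the Markov
    property at the first visit to [(z - c, z)] after [M], on a dyadic grid,
    [P(A /\ D) <= (1 - p) P(A)] for [A] in the past of [M]; letting [A] decrease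
    to [D] as [M] grows gives [P(D) = 0].  Climbs of [jc, (j + 1)c] are then
    concatenated.  Restarting just below [z] instead of at [z] avoids hitting
    times of points and the strong Markov property. *)

(** * Dyadic times *)

Definition dyadic (R : realType) (u : R) : Prop :=
  exists N k : nat, u = k%:R / 2 ^+ N.

Lemma dyadic_ge0 (R : realType) (u : R) : dyadic u -> 0 <= u.
Proof. by move=> [N [k ->]]; rewrite divr_ge0// exprn_ge0. Qed.

Lemma dyadic_nat (R : realType) (n : nat) : dyadic (n%:R : R).
Proof. by exists 0%N, n; rewrite expr0 divr1. Qed.

Lemma dyadic_refine (R : realType) (N M k : nat) : (N <= M)%N ->
  k%:R / 2 ^+ N = (k * 2 ^ (M - N))%:R / 2 ^+ M :> R.
Proof.
move=> NM; rewrite -[in 2 ^+ M](subnK NM) natrM natrX exprD.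
have h n : (2 : R) ^+ n != 0 by rewrite expf_neq0.
by have := h N; have := h (M - N)%N; set x := 2 ^+ _; set y := 2 ^+ _ => ? ?; field; apply/andP.
Qed.

Lemma dyadicD (R : realType) (u v : R) : dyadic u -> dyadic v -> dyadic (u + v).
Proof.
move=> [N [k ->]] [M [l ->]].
rewrite (dyadic_refine _ k (leq_maxl N M)) (dyadic_refine _ l (leq_maxr N M)).
by rewrite -mulrDl -natrD; do 2!eexists.
Qed.

Lemma exists_exp2_lt (R : realType) (e : R) : 0 < e ->
  exists n0, forall n, (n0 <= n)%N -> 2 ^- n < e.
Proof.
move=> e0; exists (Num.truncn e^-1).+1 => n n0n.
rewrite invf_plt ?posrE ?exprn_gt0//.
apply: lt_le_trans (truncnS_gt _) _.
by rewrite -natrX ler_nat (leq_trans n0n)// ltnW// ltn_expl.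
Qed.

Lemma dyadic_between (R : realType) (s t : R) : 0 <= s -> s < t ->
  exists2 u, dyadic u & s < u < t.
Proof.
move=> s0 st.
have [|n /(_ _ (leqnn n)) hn] := @exists_exp2_lt R (t - s); first by rewrite subr_gt0.
have p0 : (0 : R) < 2 ^+ n by rewrite exprn_gt0.
exists ((Num.truncn (s * 2 ^+ n)).+1%:R / 2 ^+ n); first by do 2!eexists.
have /andP[h1 h2] := @truncn_itv _ (s * 2 ^+ n) (mulr_ge0 s0 (ltW p0)).
rewrite ltr_pdivlMr// h2/= ltr_pdivrMr//.
have : 2 ^- n * 2 ^+ n < (t - s) * 2 ^+ n by rewrite ltr_pM2r.
by rewrite mulVf ?gt_eqF// mulrBl -[(Num.truncn _).+1%:R]natr1; lra.
Qed.

Lemma cadlag_dyadic (R : realType) (f : R -> R) (s e : R) :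
  cadlag f -> 0 <= s -> 0 < e ->
  exists u, [/\ dyadic u, s < u, u < s + e & `|f u - f s| < e].
Proof.
move=> [fr _] s0 e0; have /cvgrPdist_lt/(_ _ e0) := fr _ s0.
rewrite near_withinE => /nbhs_ballP[d /= d0 hd].
have [|u du /andP[su ut]] := @dyadic_between R s (s + Num.min d e) s0.
  by rewrite ltrDl lt_min d0.
have ud : u < s + d by apply: lt_le_trans ut _; rewrite lerD2l ge_min lexx.
exists u; split => //; first by apply: lt_le_trans ut _; rewrite lerD2l ge_min lexx orbT.
rewrite distrC; apply: hd => //.
by rewrite /ball/= ltr0_norm; lra.
Qed.

(** * Chains, crossings and climbs of a deterministic path *)

Fixpoint chain (R : realType) (f : R -> R) (e t r : R) (xs : seq R) : Prop :=
  if xs is x :: xs' then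
    exists2 u, dyadic u & [/\ r <= u, u <= t, `|f u - x| < e & chain f e t u xs']
  else True.

(** The grid is anchored at [a] and its last point may fall short of [b]; lowering [b] therefore
    only truncates the list. *)
Definition level_grid (R : realType) (a b : R) (n : nat) : seq R :=
  [seq a + j%:R / 2 ^+ n | j <- iota 0 (Num.truncn ((b - a) * 2 ^+ n)).+1].

Definition crosses (R : realType) (f : R -> R) (r t a b : R) : Prop :=
  forall n, chain f (2 ^- n) t r (level_grid a b n).

(** The times [u] may lie on either side of [s], so that for a cadlag path both the value and the
    left limit at [s] qualify. *)
Definition near_hit (R : realType) (f : R -> R) (r x s : R) : Prop :=
  forall e, 0 < e ->
    exists u, [/\ dyadic u, r <= u, `|u - s| < e & `|f u - x| < e].

Definition climb (R : realType) (f : R -> R) (r t a b : R) (L : R -> R) : Prop :=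
  [/\ forall x y, a <= x -> x <= y -> y <= b -> L x <= L y,
      forall x, a <= x -> x <= b -> r <= L x <= t &
      forall x, a <= x -> x <= b -> near_hit f r x (L x)].

Lemma chain_le (R : realType) (f : R -> R) (e t t' r r' : R) (xs : seq R) :
  r' <= r -> t <= t' -> chain f e t r xs -> chain f e t' r' xs.
Proof.
move=> + tt'; elim: xs r r' => [//|x xs ih] r r' r'r [u du [ru ut fu c]].
exists u => //; split=> //; [exact: le_trans ru|exact: le_trans tt'|].
exact: ih c.
Qed.

Lemma chain_cat (R : realType) (f : R -> R) (e t r : R) (xs ys : seq R) :
  chain f e t r (xs ++ ys) -> chain f e t r xs.
Proof.
by elim: xs r => [//|x xs ih] r [u du [ru ut fu c]]; exists u => //; split=> //; exact: ih.
Qed.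

(** The grid up to [b'] is a prefix of the grid up to [b], so a chain for the latter can be cut. *)
Lemma crosses_le (R : realType) (f : R -> R) (r t t' r' a b b' : R) :
  r' <= r -> t <= t' -> b' <= b -> crosses f r t a b -> crosses f r' t' a b'.
Proof.
move=> rr tt bb c n; apply: (chain_le rr tt).
have /subnKC k : ((Num.truncn ((b' - a) * 2 ^+ n)).+1 <= (Num.truncn ((b - a) * 2 ^+ n)).+1)%N.
  by rewrite ltnS le_truncn// ler_wpM2r ?exprn_ge0// lerB.
by have := c n; rewrite /level_grid -k iotaD map_cat => /chain_cat.
Qed.

Lemma chain_points (R : realType) (f : R -> R) (e t r : R) (xs : seq R) :
  chain f e t r xs -> exists v : nat -> R,
    (forall i j, (i <= j)%N -> (j < size xs)%N -> v i <= v j) /\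
    (forall j, (j < size xs)%N ->
       [/\ dyadic (v j), r <= v j, v j <= t & `|f (v j) - nth 0 xs j| < e]).
Proof.
elim: xs r => [|x xs ih] r /=; first by exists (fun=> 0).
move=> [u du [ru ut fu /ih[v [v1 v2]]]].
exists (fun j => if j is j'.+1 then v j' else u); split.
- move=> [|i] [|j]//= ij js; last exact: v1.
  by have [] := v2 _ js.
- move=> [|j]//= js; have [? ? ? ?] := v2 _ js; split=> //.
  exact: le_trans ru _.
Qed.

(** Compactness: [L x] is the limsup over [n] of the time at which the [n]-th chain visits the grid
    level just below [x]. A limsup keeps monotonicity in [x], and infinitely many chains come close
    to it. *)
Lemma crosses_climb (R : realType) (f : R -> R) (r t a b : R) : a <= b ->
  crosses f r t a b -> exists L, climb f r t a b L.
Proof.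
move=> ab c.
have /choice[v hv] n := chain_points (c n).
pose idx n x := Num.truncn ((x - a) * 2 ^+ n).
pose u n x := v n (idx n x).
have p0 n : (0 : R) < 2 ^+ n by rewrite exprn_gt0.
have le_idx n x y : x <= y -> (idx n x <= idx n y)%N.
  by move=> xy; rewrite le_truncn// ler_wpM2r ?lerB// ltW.
have sz n : size (level_grid a b n) = (idx n b).+1 by rewrite size_map size_iota.
have ule n x y : x <= y -> y <= b -> u n x <= u n y.
  by move=> xy yb; apply: (hv n).1; rewrite ?le_idx// sz ltnS le_idx.
(* One [2 ^- n] comes from the chain, the other from rounding [x] down to the grid. *)
have uP n x : a <= x -> x <= b ->
    [/\ dyadic (u n x), r <= u n x, u n x <= t & `|f (u n x) - x| < 2 ^- n + 2 ^- n].
  move=> ax xb; have ilt : (idx n x < (idx n b).+1)%N by rewrite ltnS le_idx.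
  have [|? ? ?] := (hv n).2 (idx n x); first by rewrite sz.
  rewrite (nth_map 0%N) ?size_iota// nth_iota// add0n => fe; split => //.
  have /andP[h1 h2] := @truncn_itv _ ((x - a) * 2 ^+ n)
    (mulr_ge0 (eqbRL (subr_ge0 _ _) ax) (ltW (p0 n))).
  rewrite -(subrKA (a + (idx n x)%:R / 2 ^+ n)).
  apply: le_lt_trans (ler_normD _ _) _; apply: ltr_leD => //.
  have h1' : (idx n x)%:R / 2 ^+ n <= x - a by rewrite ler_pdivrMr.
  have h2' : x - a <= (idx n x)%:R / 2 ^+ n + 2 ^- n.
    have -> : (idx n x)%:R / 2 ^+ n + 2 ^- n = (idx n x).+1%:R / 2 ^+ n :> R.
      by rewrite -[(idx n x).+1%:R]natr1 mulrDl mul1r.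
    by rewrite ler_pdivlMr// ltW.
  by rewrite ler_norml; apply/andP; split; lra.
pose S x := [set s | exists N, forall n, (N <= n)%N -> u n x <= s].
have St x : a <= x -> x <= b -> S x t.
  by move=> ax xb; exists 0%N => n _; have [] := uP n x ax xb.
have Sr x s : a <= x -> x <= b -> S x s -> r <= s.
  by move=> ax xb [N /(_ N (leqnn _))]; apply: le_trans; have [] := uP N x ax xb.
have hS x : a <= x -> x <= b -> has_inf (S x).
  by move=> ax xb; split; [exists t; exact: St|exists r => s; exact: Sr].
exists (fun x => inf (S x)); split.
- move=> x y ax xy yb.
  have xb := le_trans xy yb; have ay := le_trans ax xy.
  apply: lb_le_inf; first by exists t; exact: St.
  move=> s [N hN]; apply: ge_inf; first by have [] := hS _ ax xb.
  by exists N => n /hN; apply: le_trans; exact: ule.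
- move=> x ax xb; apply/andP; split.
    by apply: lb_le_inf; [exists t; exact: St|move=> s; exact: Sr].
  by apply: ge_inf; [have [] := hS _ ax xb|exact: St].
- move=> x ax xb e e0.
  have [s [N1 hN1] sL] := inf_adherent e0 (hS _ ax xb).
  have [N2 hN2] : exists n0, forall n, (n0 <= n)%N -> 2 ^- n < e / 2.
    by apply: exists_exp2_lt; rewrite divr_gt0.
  have [n [Nn nL]] : exists n, (maxn N1 N2 <= n)%N /\ inf (S x) - e / 2 < u n x.
    apply/not_existsP => hn.
    have : S x (inf (S x) - e / 2).
      exists (maxn N1 N2) => n Nn; rewrite leNgt; apply/negP => nL.
      by apply: (hn n).
    have [_ lb] := hS _ ax xb => /(ge_inf lb); lra.
  have [? ? ? fe] := uP n x ax xb.
  exists (u n x); split => //.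
    have : u n x <= s by apply: hN1; rewrite (leq_trans _ Nn)// leq_maxl.
    by rewrite ltr_norml => us; apply/andP; split; lra.
  apply: lt_le_trans fe _.
  have := hN2 n; rewrite (leq_trans _ Nn) ?leq_maxr// => /(_ isT); lra.
Qed.

Lemma near_hit_gt (R : realType) (f : R -> R) (r r' x s : R) :
  near_hit f r x s -> r' < s -> near_hit f r' x s.
Proof.
move=> h rs e e0.
have [|u [du ru us fu]] := h (Num.min e (s - r')).
  by rewrite lt_min e0 subr_gt0.
move: us fu; rewrite !lt_min => /andP[us us'] /andP[fu _].
exists u; split => //.
by move: us'; rewrite ltr_norml => /andP[+ _]; lra.
Qed.

(** Greedy choice: the times [L x] are strictly separated, so each dyadic time can be taken close
    enough to its [L x] to precede all later ones. *)
Lemma near_hit_chain (R : realType) (f L : R -> R) (e t r : R) (xs : seq R) :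
  0 < e -> pairwise (fun x y => L x < L y) xs ->
  (forall x, x \in xs -> r <= L x < t) ->
  (forall x, x \in xs -> near_hit f r x (L x)) ->
  chain f e t r xs.
Proof.
move=> e0; elim: xs r => [//|x xs ih] r /= /andP[/allP Lx pxs] bd nh.
have [d d0 hd] : exists2 d, 0 < d & forall y, y \in xs -> L x + d <= L y.
  elim: xs Lx {ih pxs bd nh} => [|y xs ih] h; first by exists 1.
  have [|d d0 hd] := ih; first by move=> z zx; apply: h; rewrite in_cons zx orbT.
  have /= xy := h y (mem_head _ _).
  exists (Num.min d (L y - L x)); first by rewrite lt_min d0 subr_gt0.
  move=> z; rewrite in_cons => /predU1P[->|/hd zd].
    by rewrite addrC -lerBrDr ge_min lexx orbT.
  by apply: le_trans zd; rewrite lerD2l ge_min lexx.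
have /andP[rx xt] := bd x (mem_head _ _).
have [|u [du ru us fu]] := nh x (mem_head _ _) (Num.min e (Num.min d (t - L x))).
  by rewrite !lt_min e0 d0 subr_gt0.
move: us fu; rewrite !lt_min => /and3P[us usd ust] /andP[fu _].
have uLt : u < t by move: ust; rewrite ltr_norml => /andP[_]; lra.
have uLd : u < L x + d by move: usd; rewrite ltr_norml => /andP[_]; lra.
exists u => //; split => //; first exact: ltW.
apply: ih => // y yxs.
  have /andP[_ ->] := bd y (mem_behead (s := x :: xs) yxs).
  by rewrite andbT ltW// (lt_le_trans uLd)// hd.
apply: near_hit_gt (nh _ (mem_behead (s := x :: xs) yxs)) _.
by rewrite (lt_le_trans uLd)// hd.
Qed.

(** If [x] differs from [f s], right continuity keeps the approximating times out of some
    [[s, s + d)]; they then tend to [s] from the left, and [x] is the left limit. *)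
Lemma near_hit_values (R : realType) (f : R -> R) (r x s : R) :
  cadlag f -> 0 <= r -> 0 <= s -> near_hit f r x s ->
  x = f s \/ x = lim (f @ s^'-).
Proof.
move=> [fr fl] r0 s0 nh.
have [->|xs] := eqVneq x (f s); [by left|right].
have e0 : 0 < `|x - f s| / 2 by rewrite divr_gt0// normr_gt0 subr_eq0.
have /cvgrPdist_lt/(_ _ e0) := fr _ s0.
rewrite near_withinE => /nbhs_ballP[d /= d0 hd].
have far u : s <= u -> u < s + d -> `|f u - x| >= `|x - f s| / 2.
  move=> su ud.
  have : `|f s - f u| < `|x - f s| / 2.
    have [->|us] := eqVneq u s; first by rewrite subrr normr0.
    apply: hd; last by rewrite lt_neqAle eq_sym us.
    by rewrite /ball/= ler0_norm; lra.
  have := ler_distD (f u) x (f s); rewrite (distrC (f s) (f u)) (distrC x (f u)); lra.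
have nh' e : 0 < e -> exists u, [/\ 0 <= u, s - e < u, u < s & `|f u - x| < e].
  move=> e1; have [|u [du ru us fu]] := nh (Num.min e (Num.min d (`|x - f s| / 2))).
    by rewrite !lt_min e1 d0.
  move: us fu; rewrite !lt_min => /and3P[us usd ust] /and3P[fu _ fux].
  have us' : u < s.
    rewrite ltNge; apply/negP => su; have := far u su.
    rewrite leNgt fux => h; suff : false by [].
    by apply: h; move: usd; rewrite ltr_norml => /andP[_]; lra.
  exists u; split => //; first exact: dyadic_ge0.
  by move: us; rewrite ltr_norml => /andP[? _]; lra.
have s1 : 0 < s by have [u [u0 _ us _]] := nh' _ d0; exact: le_lt_trans us.
apply/eqP/negPn/negP => xl.
have k0 : 0 < `|x - lim (f @ s^'-)| / 2 by rewrite divr_gt0// normr_gt0 subr_eq0.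
have /cvgrPdist_lt/(_ _ k0) := fl _ s1.
rewrite near_withinE => /nbhs_ballP[k /= k1 hk].
have [|u [u0 usk us fu]] := nh' (Num.min k (`|x - lim (f @ s^'-)| / 2)).
  by rewrite lt_min k1.
have ku : s - k < u.
  by apply: le_lt_trans usk; rewrite lerB// ge_min lexx.
have /= := hk u; rewrite /ball/= gtr0_norm; last lra.
move=> /(_ ltac:(lra) us) h.
move: fu; rewrite lt_min => /andP[_ fu].
have := ler_distD (f u) x (lim (f @ s^'-)).
by rewrite (distrC x (f u)) (distrC (f u) (lim _)); lra.
Qed.

(** If [L x = L y], the midpoint level has the same time by monotonicity, and three distinct levels
    would share the two candidate values there. *)
Lemma climb_lt (R : realType) (f : R -> R) (r t a b : R) (L : R -> R) :
  cadlag f -> 0 <= r -> climb f r t a b L ->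
  forall x y, a <= x -> x < y -> y <= b -> L x < L y.
Proof.
move=> cf r0 [Lm Lb Lh] x y ax xy yb.
have ay : a <= y by lra. have xb : x <= b by lra.
have := Lm x y ax (ltW xy) yb; rewrite le_eqVlt => /predU1P[Lxy|//]; exfalso.
pose m := (x + y) / 2.
have am : a <= m by rewrite /m; lra. have mb : m <= b by rewrite /m; lra.
have xm : x < m by rewrite /m; lra. have my : m < y by rewrite /m; lra.
have Lxm : L m = L x.
  by apply/eqP; rewrite eq_le {1}Lxy (Lm _ _ am (ltW my) yb) (Lm _ _ ax (ltW xm) mb).
have s0 : 0 <= L x by apply: le_trans r0 _; have /andP[] := Lb x ax xb.
have hx := near_hit_values cf r0 s0 (Lh x ax xb).
have := near_hit_values cf r0 s0; move: (Lh m am mb) (Lh y ay yb).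
rewrite Lxm -Lxy => h1 h2 h; move: (h _ h1) (h _ h2) hx.
by move=> [e1|e1] [e2|e2] [e3|e3]; lra.
Qed.

Lemma mem_level_grid (R : realType) (a b : R) n x : a <= b ->
  x \in level_grid a b n -> a <= x <= b.
Proof.
move=> ab /mapP[j]; rewrite mem_iota add0n ltnS => /andP[_ jb] ->.
have p0 : (0 : R) < 2 ^+ n by rewrite exprn_gt0.
rewrite lerDl divr_ge0 ?(ltW p0)//= addrC -lerBrDr ler_pdivrMr//.
by rewrite -truncn_ge_nat// mulr_ge0 ?(ltW p0)// subr_ge0.
Qed.

(** Converse of the compactness step. The strict [t < t'] leaves room for dyadic times slightly
    after [L x], which may equal [t]. *)
Lemma climb_crosses (R : realType) (f : R -> R) (r t t' a b : R) (L : R -> R) :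
  cadlag f -> 0 <= r -> a <= b -> t < t' -> climb f r t a b L ->
  crosses f r t' a b.
Proof.
move=> cf r0 ab tt' cl n; have [Lm Lb Lh] := cl.
apply: (@near_hit_chain _ f L).
- by rewrite invr_gt0 exprn_gt0.
- rewrite pairwise_map; apply: (sub_in_pairwise (r := ltn)
    (P := mem (iota 0 (Num.truncn ((b - a) * 2 ^+ n)).+1))).
  + move=> i j iI jI /= ij.
    have /andP[ai _] := mem_level_grid ab (map_f (fun j : nat => a + j%:R / 2 ^+ n) iI).
    have /andP[_ jb] := mem_level_grid ab (map_f (fun j : nat => a + j%:R / 2 ^+ n) jI).
    apply: (climb_lt cf r0 cl) => //.
    by rewrite ltrD2l ltr_pM2r ?ltr_nat// invr_gt0 exprn_gt0.
  + by apply/allP.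
  + by rewrite -sorted_pairwise ?iota_ltn_sorted//; exact: ltn_trans.
- move=> x /(mem_level_grid ab)/andP[ax xb].
  by have /andP[-> ?] := Lb x ax xb; exact: le_lt_trans tt'.
- by move=> x /(mem_level_grid ab)/andP[ax xb]; exact: Lh.
Qed.

Lemma near_hit_le (R : realType) (f : R -> R) (r r' x s : R) :
  r' <= r -> near_hit f r x s -> near_hit f r' x s.
Proof.
move=> rr h e /h[u [du ru us fu]]; exists u; split => //; exact: le_trans ru.
Qed.

Lemma climb_sub (R : realType) (f : R -> R) (r t a b a' b' : R) (L : R -> R) :
  a <= a' -> b' <= b -> climb f r t a b L -> climb f r t a' b' L.
Proof.
move=> aa bb [h1 h2 h3]; split.
- by move=> x y ax xy yb; apply: h1 => //; lra.
- by move=> x ax xb; apply: h2; lra.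
- by move=> x ax xb; apply: h3; lra.
Qed.

(** Translation by a dyadic [s] keeps the approximating times dyadic. *)
Lemma climb_shift (R : realType) (f : R -> R) (s t a b : R) (L : R -> R) :
  dyadic s -> climb (fun u => f (s + u) - f s) 0 t a b L ->
  climb f s (s + t) (f s + a) (f s + b) (fun x => s + L (x - f s)).
Proof.
move=> ds [h1 h2 h3]; split.
- by move=> x y ax xy yb; rewrite lerD2l; apply: h1; lra.
- move=> x ax xb; have /andP[] : 0 <= L (x - f s) <= t by apply: h2; lra.
  by move=> ? ?; apply/andP; split; lra.
- move=> x ax xb e e0.
  have [||u [du u0 uL fu]] := h3 (x - f s) _ _ e e0; [lra|lra|].
  exists (s + u); split; first exact: dyadicD.
  + lra.
  + by rewrite (_ : s + u - _ = u - L (x - f s)) //; ring.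
  + by rewrite (_ : f (s + u) - x = f (s + u) - f s - (x - f s)) //; ring.
Qed.

Lemma climb_cat (R : realType) (f : R -> R) (r t r' t' a b c : R) (L L' : R -> R) :
  a <= b -> b <= c -> t <= r' -> climb f r t a b L -> climb f r' t' b c L' ->
  exists M, climb f r t' a c M.
Proof.
move=> ab bc tr [h1 h2 h3] [k1 k2 k3].
exists (fun x => if x <= b then L x else L' x); split.
- move=> x y ax xy yc; case: (leP y b) => yb.
    by rewrite ifT; [exact: h1|lra].
  case: (leP x b) => xb; last by apply: k1; lra.
  have /andP[_ ?] := h2 _ ax xb.
  have /andP[? _] : r' <= L' y <= t' by apply: k2; lra.
  lra.
- move=> x ax xc; have /andP[? _] := h2 _ ab (lexx b); have /andP[_ ?] := h2 _ ab (lexx b).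
  case: (leP x b) => xb.
    have /andP[-> ?] := h2 _ ax xb.
    have /andP[? ?] := k2 _ (lexx b) bc; lra.
  have /andP[? ?] : r' <= L' x <= t' by apply: k2; lra.
  by apply/andP; split; lra.
- move=> x ax xc; case: (leP x b) => xb; first exact: h3.
  have /andP[? ?] := h2 _ ab (lexx b).
  by apply: (@near_hit_le _ f r'); [lra|apply: k3; lra].
Qed.

(** By right continuity, dyadic times just after [K x] carry values close to [x]. *)
Lemma inverse_climb (R : realType) (f K : R -> R) (b : R) : cadlag f ->
  (forall x, 0 <= x -> x <= b -> 0 <= K x) ->
  (forall x y, 0 <= x -> x <= y -> y <= b -> K x <= K y) ->
  (forall x, 0 <= x -> x <= b -> f (K x) = x) ->
  climb f 0 (K b) 0 b K.
Proof.
move=> cf K0 Km Kf; split => //.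
- by move=> x x0 xb; rewrite K0// Km.
- move=> x x0 xb e e0.
  have [u [du su us fu]] := cadlag_dyadic cf (K0 _ x0 xb) e0.
  exists u; split => //; first exact: dyadic_ge0.
    by rewrite gtr0_norm; lra.
  by rewrite -[x in _ - x]Kf.
Qed.

(** The right-continuous version of the earliest climb: the levels reached lie strictly above [x].
    Dyadic [t] turns a bound on the infimum into a countable condition. *)
Definition first_climb (R : realType) (f : R -> R) (x : R) : R :=
  inf [set t | dyadic t /\ exists j : nat, crosses f 0 t 0 (x + j.+1%:R^-1)].

(** Dyadic times strictly after [first_climb f x] and arbitrarily close to it carry values close to
    [x]; right continuity then forces equality. *)
Lemma first_climb_inverse (R : realType) (f : R -> R) : cadlag f ->
  (forall y, 0 <= y -> exists t, crosses f 0 t 0 y) ->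
  [/\ forall x, 0 <= x -> 0 <= first_climb f x,
      forall x y, 0 <= x -> x <= y -> first_climb f x <= first_climb f y &
      forall x, 0 <= x -> f (first_climb f x) = x].
Proof.
move=> cf hf.
pose S x := [set t | dyadic t /\ exists j : nat, crosses f 0 t 0 (x + j.+1%:R^-1)].
have S0 x t : S x t -> 0 <= t by case=> + _; exact: dyadic_ge0.
have hS x : 0 <= x -> has_inf (S x).
  move=> x0; split; last by exists 0 => t; exact: S0.
  have [|t ht] := hf (x + 1); first by rewrite addr_ge0.
  exists (Num.truncn t).+1%:R; split; first exact: dyadic_nat.
  exists 0%N; rewrite invr1; apply: crosses_le ht => //.
  by rewrite ltW// truncnS_gt.
have F0 x : 0 <= x -> 0 <= first_climb f x.
  by move=> x0; apply: lb_le_inf; [exact: (hS _ x0).1|move=> t; exact: S0].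
split => //.
- move=> x y x0 xy; apply: lb_le_inf; first by apply: (hS _ _).1; lra.
  move=> t [dt [j hj]]; apply: ge_inf; first exact: (hS _ x0).2.
  split => //; exists j; apply: crosses_le hj => //.
  by rewrite lerD2r.
- move=> x x0; set k := first_climb f x.
  have k0 : 0 <= k := F0 _ x0.
  (* [L y] overshoots [k] strictly because a climb is strictly increasing. *)
  have key e : 0 < e -> exists u, [/\ k < u, u < k + e & `|f u - x| < e].
    move=> e0.
    have e2 : 0 < e / 2 by rewrite divr_gt0.
    have [t [dt [j hj]] tk] := inf_adherent e2 (hS _ x0).
    (* [h] is at most the overshoot and below [e / 2], so the levels [y] and [z] stay within [e / 2]
       of [x]. *)
    have [h [h0 he ch]] : exists h : R, [/\ 0 < h, h < e / 2 & crosses f 0 t 0 (x + h)].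
      exists (Num.min j.+1%:R^-1 (e / 4)); split.
      - by rewrite lt_min invr_gt0 ltr0n/=; lra.
      - by rewrite gt_min; apply/orP; right; lra.
      - by apply: crosses_le hj => //; rewrite lerD2l ge_min lexx.
    have [|L cl] := crosses_climb _ ch; first by lra.
    have [_ Lb Lh] := cl.
    pose y := x + h / 2; pose z := x + h / 4.
    have LL : L z < L y.
      by apply: (climb_lt cf _ cl) => //; rewrite /z /y; lra.
    (* Were [L z < k], the climb cut at level [z] would end before some dyadic [v < k]; as [z]
       exceeds [x], this puts [v] in [S x], below its infimum. *)
    have kL : k <= L z.
      rewrite leNgt; apply/negP => Lzk.
      have /andP[Lz0 _] : 0 <= L z <= t by apply: Lb; rewrite /z; lra.
      have [v dv /andP[Lv vk]] := dyadic_between Lz0 Lzk.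
      suff /(ge_inf (hS _ x0).2) : S x v by rewrite leNgt [X in _ < X]/(first_climb f x) vk.
      split => //.
      have [m hm] : exists m : nat, (m.+1%:R^-1 : R) <= h / 4.
        exists (Num.truncn (h / 4)^-1).
        rewrite invf_ple ?posrE ?ltr0n//; first by rewrite ltW// truncnS_gt.
        by rewrite divr_gt0.
      exists m; apply: (@crosses_le _ f 0 v v 0 0 z) => //; first by rewrite lerD2l.
      apply: (climb_crosses cf _ _ Lv); rewrite ?/z; [by []|lra|].
      have := climb_sub (lexx 0) (_ : z <= x + h) cl; rewrite /z => /(_ ltac:(lra)).
      move=> [c1 c2 c3]; split; [exact: c1| |exact: c3] => w w0 wz.
      by have /andP[-> _] := c2 _ w0 wz; apply: c1.
    have /andP[_ Lyt] : 0 <= L y <= t by apply: Lb; rewrite /y; lra.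
    have {}tk : t < k + e / 2 by exact: tk.
    have [y0 yh] : 0 <= y /\ y <= x + h by split; rewrite /y; lra.
    have [|u [du _ uL fu]] := Lh y y0 yh (Num.min (L y - k) (e / 2)).
      by rewrite lt_min e2 andbT; lra.
    move: uL fu; rewrite !lt_min => /andP[uL uL2] /andP[_ fu].
    exists u; split.
    + by move: uL; rewrite -/y ltr_norml => /andP[? _]; lra.
    + by move: uL2; rewrite -/y ltr_norml => /andP[_ ?]; lra.
    + by move: fu; rewrite /y !ltr_norml => /andP[? ?]; apply/andP; split; lra.
  apply/eqP/negPn/negP => fx.
  have d0 : 0 < `|f k - x| / 2 by rewrite divr_gt0// normr_gt0 subr_eq0.
  have /cvgrPdist_lt/(_ _ d0) := cf.1 _ k0.
  rewrite near_withinE => /nbhs_ballP[d /= d1 hd].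
  have [|u [ku ud fu]] := key (Num.min d (`|f k - x| / 2)); first by rewrite lt_min d1.
  move: fu; rewrite lt_min => /andP[_ fu].
  have ud' : u < k + d by apply: lt_le_trans ud _; rewrite lerD2l ge_min lexx.
  have := hd u; rewrite /ball/= ltr0_norm; last lra.
  move=> /(_ ltac:(lra) ku).
  have := ler_distD (f u) (f k) x; lra.
Qed.

(** * The Markov property at dyadic times *)

Lemma pi_lambda_product d (T : measurableType d) (R : realType)
    (P : probability T R) (S : Type) (C : set_system S) (phi psi : T -> S)
    (A : set T) : setI_closed C -> measurable A ->
  (forall D, C D -> [/\ measurable (phi @^-1` D), measurable (psi @^-1` D) &
     P (A `&` phi @^-1` D) = (P A * P (psi @^-1` D))%E]) ->
  forall D, <<s C>> D -> [/\ measurable (phi @^-1` D), measurable (psi @^-1` D) &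
     P (A `&` phi @^-1` D) = (P A * P (psi @^-1` D))%E].
Proof.
(* The sets [D] with all three properties form a Dynkin system. Measurability of the preimages is
   carried along, being given only on [C]. *)
move=> CI mA hC; rewrite -setI_closed_g_dynkin_g_sigma_algebra//.
apply: smallest_sub => //; split.
- by rewrite !preimage_setT setIT probability_setT mule1; split.
- move=> D [m1 m2 e].
  have cE (f : T -> S) : f @^-1` (~` D) = ~` (f @^-1` D) by [].
  rewrite (cE phi) (cE psi); move: (phi @^-1` D) (psi @^-1` D) m1 m2 e => U V mU mV e.
  split; [exact: measurableC|exact: measurableC|].
  have -> : P (A `&` ~` U) = (P A - P A * P V)%E.
    rewrite -e -setDE; apply: measureD => //.
    by rewrite (le_lt_trans (probability_le1 _ _)) ?ltry.
  have fA : P A \is a fin_num by exact: fin_num_measure.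
  have fV : P V \is a fin_num by exact: fin_num_measure.
  rewrite probability_setC// -(fineK fA) -(fineK fV).
  by rewrite -EFinM -!EFinB -EFinM mulrBr mulr1.
- move=> F tF hF.
  have m1 n : measurable (phi @^-1` F n) by have [] := hF n.
  have m2 n : measurable (psi @^-1` F n) by have [] := hF n.
  have tI (f : T -> S) i j : i != j -> f @^-1` F i `&` f @^-1` F j = set0.
    move=> ij; move/trivIsetP: tF => /(_ i j I I ij) Fij.
    by rewrite [LHS](_ : _ = f @^-1` (F i `&` F j))// Fij.
  have t2 : trivIset setT (fun n => psi @^-1` F n).
    by apply/trivIsetP => i j _ _; exact: tI.
  have t1 : trivIset setT (fun n => A `&` phi @^-1` F n).
    by apply/trivIsetP => i j _ _ ij; rewrite setIACA tI// setI0.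
  have bE (f : T -> S) : f @^-1` (\bigcup_k F k) = \bigcup_k (f @^-1` F k).
    exact: preimage_bigcup.
  rewrite (bE phi) (bE psi).
  split; [exact: bigcupT_measurable|exact: bigcupT_measurable|].
  rewrite setI_bigcupr !measure_bigcup//; last by move=> n _; exact: measurableI.
  rewrite -[P A]fineK ?fin_num_measure// -nneseriesZl//.
  by apply: eq_eseriesr => n _; have [_ _ h] := hF n; rewrite fineK ?fin_num_measure//; exact: h.
Qed.

Definition path_from (R : realType) (T : Type) (X : R -> T -> R) (s : R) (w : T)
    : R -> R :=
  fun u => X (s + u) w.

(** Rectangles constrain increments rather than values, so that independence and stationarity apply
    to them directly. *)
Definition grid_rect (R : realType) (N n : nat) (B : nat -> set R) : set (R -> R) :=
  [set f | forall i, (i < n)%N -> B i (f (i.+1%:R / 2 ^+ N) - f (i%:R / 2 ^+ N))].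

Lemma grid_rectE (R : realType) (N n : nat) (B : nat -> set R) :
  grid_rect N n B = \bigcap_(i < n)
    [set f | B i (f (i.+1%:R / 2 ^+ N) - f (i%:R / 2 ^+ N))].
Proof. by apply/seteqP; split => f hf i; exact: hf. Qed.

Lemma grid_rectI (R : realType) (N n m : nat) (B B' : nat -> set R) :
  grid_rect N n B `&` grid_rect N m B' = grid_rect N (maxn n m)
    (fun i => (if (i < n)%N then B i else setT) `&` (if (i < m)%N then B' i else setT)).
Proof.
apply/seteqP; split => f.
- by move=> [h h'] i _; split; case: ifP => // ?; [exact: h|exact: h'].
- move=> h; split=> i im; have := h i; rewrite leq_max im ?orbT => /(_ isT)[]//.
Qed.

Definition past_rects (R : realType) (N m : nat) : set_system (R -> R) :=
  [set A | exists2 B : nat -> set R, (forall i, measurable (B i)) & A = grid_rect N m B].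

Definition future_rects (R : realType) (N : nat) : set_system (R -> R) :=
  [set A | exists n, past_rects N n A].

Lemma past_rects_setI (R : realType) N m : setI_closed (@past_rects R N m).
Proof.
move=> _ _ [B mB ->] [B' mB' ->]; rewrite grid_rectI maxnn.
eexists; last reflexivity.
by move=> i /=; case: ifP => _; apply: measurableI.
Qed.

Lemma future_rects_setI (R : realType) N : setI_closed (@future_rects R N).
Proof.
move=> _ _ [n [B mB ->]] [m [B' mB' ->]]; rewrite grid_rectI.
exists (maxn n m); eexists; last reflexivity.
by move=> i /=; apply: measurableI; case: ifP.
Qed.

Lemma grid_ge0 (R : realType) (N i : nat) : 0 <= (i%:R / 2 ^+ N : R).
Proof. by rewrite divr_ge0// exprn_ge0. Qed.

Section markov.
Context (R : realType) (d : measure_display) (T : measurableType d).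
Context (P : probability T R) (X : R -> T -> R) (levyX : levy_process P X).

Lemma measurable_increment s t : 0 <= s -> 0 <= t ->
  measurable_fun setT (increment X s t).
Proof. by move=> s0 t0; apply: measurable_funB; apply: levy_measurable levyX _ _. Qed.

Lemma measurable_increment_preimage s t (B : set R) : 0 <= s -> 0 <= t ->
  measurable B -> measurable (increment X s t @^-1` B).
Proof.
by move=> s0 t0 mB; rewrite -[_ @^-1` _]setTI; exact: measurable_increment.
Qed.

Lemma grid_rect_preimage s N n (B : nat -> set R) :
  path_from X s @^-1` grid_rect N n B = \bigcap_(i < n)
    (increment X (s + i%:R / 2 ^+ N) (s + i.+1%:R / 2 ^+ N) @^-1` B i).
Proof. by rewrite grid_rectE preimage_bigcap. Qed.

Lemma measurable_rect_preimage s N n (B : nat -> set R) : 0 <= s ->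
  (forall i, measurable (B i)) ->
  measurable (path_from X s @^-1` grid_rect N n B).
Proof.
move=> s0 mB; rewrite grid_rect_preimage; apply: bigcap_measurableType => i _.
by apply: measurable_increment_preimage; rewrite ?addr_ge0 ?grid_ge0.
Qed.

(** All [m + n] consecutive increments are independent, and stationarity moves the last [n] back to
    start at time [0]. *)
Lemma rect_markov N m n (B B' : nat -> set R) :
  (forall i, measurable (B i)) -> (forall i, measurable (B' i)) ->
  P (path_from X 0 @^-1` grid_rect N m B `&`
     path_from X (m%:R / 2 ^+ N) @^-1` grid_rect N n B') =
  (P (path_from X 0 @^-1` grid_rect N m B) *
   P (path_from X 0 @^-1` grid_rect N n B'))%E.
Proof.
move=> mB mB'.
pose t i : R := i%:R / 2 ^+ N.
have tD i j : t i + t j = t (i + j)%N by rewrite /t -mulrDl natrD.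
have tm i : t i <= t i.+1.
  by rewrite /t ler_wpM2r ?invr_ge0 ?exprn_ge0// ler_nat.
have t0 : 0 <= t 0%N by exact: grid_ge0.
have past k (D : nat -> set R) : path_from X 0 @^-1` grid_rect N k D =
    \bigcap_(i < k) (increment X (t i) (t i.+1) @^-1` D i).
  by rewrite grid_rect_preimage; apply: eq_bigcapr => i _; rewrite !add0r.
have future : path_from X (t m) @^-1` grid_rect N n B' =
    \bigcap_(i < n) (increment X (t (m + i)%N) (t (m + i).+1) @^-1` B' i).
  by rewrite grid_rect_preimage; apply: eq_bigcapr => i _; rewrite -addnS -!tD.
have indep k D (mD : forall i, measurable (D i)) :=
  levy_independent levyX k t0 tm mD.
have -> : path_from X 0 @^-1` grid_rect N m B `&` path_from X (t m) @^-1` grid_rect N n B' =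
    \bigcap_(i < m + n) (increment X (t i) (t i.+1) @^-1`
      (if (i < m)%N then B i else B' (i - m)%N)).
  rewrite past future; apply/seteqP; split => w.
  - move=> [h h'] i /= im; case: ltnP => mi; first exact: h.
    have /h' : (i - m < n)%N by rewrite ltn_subLR.
    by rewrite /= subnKC.
  - move=> h; split => i /= im.
      by have := h i (ltn_addr n im) => /=; rewrite im.
    have /= := h (m + i)%N; rewrite ltn_add2l => /(_ im).
    by rewrite ltnNge leq_addr/= addKn.
rewrite indep; last by move=> i; case: ifP.
rewrite !past !indep// big_split_ord; congr (_ * _)%E.
- by apply: eq_bigr => i _ /=; rewrite ltn_ord.
- apply: eq_bigr => i _ /=; rewrite ltnNge leq_addr/= addKn.
  have stat := levy_stationary levyX.
  have e j : t j.+1 = t j + t 1%N by rewrite tD addn1.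
  by rewrite e [t i.+1]e !stat// /t grid_ge0.
Qed.

(** Two passes of the pi-lambda argument: over [D] with a rectangle as past, then over [A] with [D]
    fixed. *)
Lemma grid_markov N m A D : <<s @past_rects R N m>> A -> <<s @future_rects R N>> D ->
  [/\ measurable (path_from X 0 @^-1` A),
      measurable (path_from X (m%:R / 2 ^+ N) @^-1` D),
      measurable (path_from X 0 @^-1` D) &
  P (path_from X 0 @^-1` A `&` path_from X (m%:R / 2 ^+ N) @^-1` D) =
  (P (path_from X 0 @^-1` A) * P (path_from X 0 @^-1` D))%E].
Proof.
move=> hA hD.
have s0 := grid_ge0 R N m.
have mr := measurable_rect_preimage.
have step1 B : (forall i, measurable (B i)) ->
    [/\ measurable (path_from X (m%:R / 2 ^+ N) @^-1` D),
        measurable (path_from X 0 @^-1` D) &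
    P (path_from X 0 @^-1` grid_rect N m B `&` path_from X (m%:R / 2 ^+ N) @^-1` D) =
    (P (path_from X 0 @^-1` grid_rect N m B) * P (path_from X 0 @^-1` D))%E].
  move=> mB; apply: (pi_lambda_product (@future_rects_setI R N)) hD; first exact: mr.
  move=> _ [n [B' mB' ->]]; split; [exact: mr|exact: mr|exact: rect_markov].
have [mD mD0 eD] := step1 (fun=> setT) (fun=> measurableT).
(* The trivial past shows that the shifted and the original path give [D] the same probability. *)
have PD : P (path_from X (m%:R / 2 ^+ N) @^-1` D) = P (path_from X 0 @^-1` D).
  have rT : @grid_rect R N m (fun=> setT) = setT by apply/seteqP; split.
  by move: eD; rewrite rT preimage_setT setTI probability_setT mul1e.
have [] := @pi_lambda_product _ _ _ P _ _ (path_from X 0) (path_from X 0)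
  (path_from X (m%:R / 2 ^+ N) @^-1` D) (@past_rects_setI R N m) mD _ A hA.
  move=> _ [B mB ->]; split; [exact: mr|exact: mr|].
  by rewrite setIC PD muleC; have [] := step1 B mB.
by move=> mA _; rewrite setIC PD muleC.
Qed.

End markov.

(** Sets seen by every fine enough grid; they form a pi-system. For non-dyadic [s] the condition is
    vacuous, hence the assumption [dyadic s] in the Markov property. *)
Definition past_sets (R : realType) (s : R) : set_system (R -> R) :=
  [set A | exists N0, forall N m, (N0 <= N)%N -> m%:R / 2 ^+ N = s ->
     <<s @past_rects R N m>> A].

Definition future_sets (R : realType) : set_system (R -> R) :=
  [set A | exists N0, forall N, (N0 <= N)%N -> <<s @future_rects R N>> A].

Lemma g_sigma_setI (R : realType) (G : set_system (R -> R)) A B :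
  <<s G>> A -> <<s G>> B -> <<s G>> (A `&` B).
Proof. exact: (@measurableI _ (g_sigma_algebraType G)). Qed.

Lemma past_sets_setI (R : realType) (s : R) : setI_closed (past_sets s).
Proof.
move=> A B [N hA] [M hB]; exists (maxn N M) => K m; rewrite geq_max => /andP[NK MK] ms.
by apply: g_sigma_setI; [exact: hA|exact: hB].
Qed.

Lemma future_sets_setI (R : realType) : setI_closed (@future_sets R).
Proof.
move=> A B [N hA] [M hB]; exists (maxn N M) => K; rewrite geq_max => /andP[NK MK].
by apply: g_sigma_setI; [exact: hA|exact: hB].
Qed.

(** The coordinate is a telescoping sum of [k] increments over grid cells. *)
Lemma grid_coordinate (R : realType) (N m k : nat) (B : set R) : (k <= m)%N ->
  measurable B ->
  <<s @past_rects R N m>> [set f | B (f (k%:R / 2 ^+ N) - f 0)].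
Proof.
move=> km mB.
pose S := g_sigma_algebraType (@past_rects R N m).
pose inc (i : nat) (f : S) : R := f (i.+1%:R / 2 ^+ N) - f (i%:R / 2 ^+ N).
have minc i : (i < m)%N -> measurable_fun setT (inc i).
  move=> im _ C mC; rewrite setTI; apply: sub_sigma_algebra.
  exists (fun j => if j == i then C else setT); first by move=> j; case: ifP.
  apply/seteqP; split => f /=.
  - by move=> hf j jm /=; case: eqP => // ->.
  - by move=> /(_ i im); rewrite eqxx.
have msum : measurable_fun setT (fun f : S => \sum_(i < k) inc i f).
  by apply: measurable_sum => i; apply: minc; rewrite (leq_trans (ltn_ord i)).
have := msum measurableT _ mB; rewrite setTI; congr (measurable _).
apply/seteqP; split => f /=; rewrite -(big_mkord xpredT (fun i => inc i f));
  by rewrite telescope_sumr// mul0r.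
Qed.

Lemma past_coordinate (R : realType) (s u : R) (B : set R) :
  dyadic u -> u <= s -> measurable B ->
  <<s past_sets s>> [set f | B (f u - f 0)].
Proof.
move=> [N0 [k ->]] us mB; apply: sub_sigma_algebra; exists N0 => N m N0N ms.
move: us; rewrite (dyadic_refine _ k N0N) -ms ler_pM2r ?invr_gt0 ?exprn_gt0//.
by rewrite ler_nat => km; exact: grid_coordinate.
Qed.

Lemma future_coordinate (R : realType) (u : R) (B : set R) :
  dyadic u -> measurable B ->
  <<s @future_sets R>> [set f | B (f u - f 0)].
Proof.
move=> [N0 [k ->]] mB; apply: sub_sigma_algebra; exists N0 => N N0N.
rewrite (dyadic_refine _ k N0N).
have := @grid_coordinate R N _ _ _ (leqnn (k * 2 ^ (N - N0))) mB.
by apply: sub_sigma_algebra2 => A hA; eexists; exact: hA.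
Qed.

Section markov_dyadic.
Context (R : realType) (d : measure_display) (T : measurableType d).
Context (P : probability T R) (X : R -> T -> R) (levyX : levy_process P X).

Lemma markov_gen s A D : dyadic s -> past_sets s A -> @future_sets R D ->
  [/\ measurable (path_from X 0 @^-1` A),
      measurable (path_from X s @^-1` D),
      measurable (path_from X 0 @^-1` D) &
  P (path_from X 0 @^-1` A `&` path_from X s @^-1` D) =
  (P (path_from X 0 @^-1` A) * P (path_from X 0 @^-1` D))%E].
Proof.
move=> [N0 [k ->]] [N1 hA] [N2 hD].
pose N := maxn N0 (maxn N1 N2).
have NN0 : (N0 <= N)%N by rewrite leq_maxl.
have NN1 : (N1 <= N)%N by rewrite /N maxnCA leq_maxl.
have NN2 : (N2 <= N)%N by rewrite /N maxnA leq_maxr.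
rewrite (dyadic_refine _ k NN0).
apply: (grid_markov levyX); last exact: hD.
by apply: hA => //; rewrite -dyadic_refine.
Qed.

(** The two pi-lambda passes are repeated with [past_sets s] and [future_sets] as pi-systems, since
    a member of each can be placed on a common grid. *)
Lemma levy_markov s A D : dyadic s -> <<s past_sets s>> A -> <<s @future_sets R>> D ->
  [/\ measurable (path_from X 0 @^-1` A),
      measurable (path_from X s @^-1` D),
      measurable (path_from X 0 @^-1` D) &
  P (path_from X 0 @^-1` A `&` path_from X s @^-1` D) =
  (P (path_from X 0 @^-1` A) * P (path_from X 0 @^-1` D))%E].
Proof.
move=> ds hA hD.
have step1 B : past_sets s B ->
    [/\ measurable (path_from X s @^-1` D),
        measurable (path_from X 0 @^-1` D) &
    P (path_from X 0 @^-1` B `&` path_from X s @^-1` D) =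
    (P (path_from X 0 @^-1` B) * P (path_from X 0 @^-1` D))%E].
  move=> hB; apply: (pi_lambda_product (@future_sets_setI R)) hD.
    have fT : @future_sets R setT.
      by exists 0%N => N _; exact: (@measurableT _ (g_sigma_algebraType _)).
    by have [] := markov_gen ds hB fT.
  by move=> E hE; have [] := markov_gen ds hB hE.
have pT : past_sets s setT.
  by exists 0%N => N m _ _; exact: (@measurableT _ (g_sigma_algebraType _)).
have [mD mD0 eD] := step1 _ pT.
have PD : P (path_from X s @^-1` D) = P (path_from X 0 @^-1` D).
  by move: eD; rewrite preimage_setT setTI probability_setT mul1e.
have [] := @pi_lambda_product _ _ _ P _ _ (path_from X 0) (path_from X 0)
  (path_from X s @^-1` D) (@past_sets_setI R s) mD _ A hA.
  move=> B hB; have fT : @future_sets R setT.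
    by exists 0%N => N _; exact: (@measurableT _ (g_sigma_algebraType _)).
  have [mB _ _ _] := markov_gen ds hB fT.
  by split => //; rewrite setIC PD muleC; have [] := step1 B hB.
by move=> mA _; rewrite setIC PD muleC.
Qed.

End markov_dyadic.

(** * Measurability of the path events *)

Definition centered (R : realType) (f : R -> R) : R -> R := fun u => f u - f 0.

Lemma measurable_near (R : realType) (x e : R) :
  measurable [set y : R | `|y - x| < e].
Proof.
rewrite (_ : [set _ | _] = ball x e); first exact: measurable_ball.
by apply/seteqP; split => y; rewrite /ball/= distrC.
Qed.

Lemma g_sigma_dyadic_exists (R : realType) (G : set_system (R -> R))
    (E : R -> set (R -> R)) :
  (forall u, dyadic u -> <<s G>> (E u)) ->
  <<s G>> [set f | exists2 u, dyadic u & E u f].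
Proof.
move=> hE.
rewrite (_ : [set _ | _] = \bigcup_N \bigcup_k E (k%:R / 2 ^+ N)).
  apply: (@bigcupT_measurable _ (g_sigma_algebraType G)) => N.
  apply: (@bigcupT_measurable _ (g_sigma_algebraType G)) => k.
  by apply: hE; do 2!eexists.
apply/seteqP; split => f.
- by move=> [_ [N [k ->]] Ef]; exists N => //; exists k.
- by move=> [N _ [k _ Ef]]; eexists; last exact: Ef; do 2!eexists.
Qed.

(** Centering makes the event depend on differences [f u - f 0] only, and each dyadic quantifier is
    a countable union. Only times up to [t] occur, which serves past and future alike. *)
Lemma g_sigma_chain (R : realType) (G : set_system (R -> R)) (e t r : R) (xs : seq R) :
  (forall u (B : set R), dyadic u -> u <= t -> measurable B ->
     <<s G>> [set f | B (f u - f 0)]) ->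
  <<s G>> [set f | chain (centered f) e t r xs].
Proof.
move=> hG; elim: xs r => [|x xs ih] r /=.
  exact: (@measurableT _ (g_sigma_algebraType G)).
apply: g_sigma_dyadic_exists => u du.
have [/andP[ru ut]|nu] := boolP ((r <= u) && (u <= t)); last first.
  rewrite [X in _ X](_ : _ = set0); last first.
    by apply/seteqP; split => f // -[ru ut _ _]; move: nu; rewrite ru ut.
  exact: (@measurable0 _ (g_sigma_algebraType G)).
rewrite [X in _ X](_ : _ = [set f | `|f u - f 0 - x| < e] `&`
    [set f | chain (centered f) e t u xs]); last first.
  by apply/seteqP; split => f; [case|move=> [? ?]].
by apply: g_sigma_setI => //; exact: (hG _ _ du ut (measurable_near x e)).
Qed.

Lemma g_sigma_crosses (R : realType) (G : set_system (R -> R)) (r t a b : R) :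
  (forall u (B : set R), dyadic u -> u <= t -> measurable B ->
     <<s G>> [set f | B (f u - f 0)]) ->
  <<s G>> [set f | crosses (centered f) r t a b].
Proof.
move=> hG.
rewrite (_ : [set _ | _] = \bigcap_n [set f |
    chain (centered f) (2 ^- n) t r (level_grid a b n)]); last first.
  by apply/seteqP; split => f h n; [move=> _|]; exact: h.
by apply: (@bigcapT_measurable _ (g_sigma_algebraType G)) => n; exact: g_sigma_chain.
Qed.

Lemma future_crosses (R : realType) (r t a b : R) :
  <<s @future_sets R>> [set f | crosses (centered f) r t a b].
Proof. by apply: g_sigma_crosses => u B du _; exact: future_coordinate. Qed.

(** Integer values of [t] give a countable union and lose nothing, as crossings are monotone in
    [t]. *)
Definition rises (R : realType) (b : R) : set (R -> R) :=
  [set f | exists t : nat, crosses (centered f) 0 t%:R 0 b].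

Definition never_crosses (R : realType) (r a b : R) : set (R -> R) :=
  [set f | forall t : nat, ~ crosses (centered f) r t%:R a b].

Lemma future_rises (R : realType) (b : R) : <<s @future_sets R>> (rises b).
Proof.
rewrite (_ : rises b = \bigcup_(t : nat) [set f | crosses (centered f) 0 t%:R 0 b]).
  apply: (@bigcupT_measurable _ (g_sigma_algebraType _)) => t; exact: future_crosses.
by apply/seteqP; split => f; [move=> [t ?]; exists t|move=> [t _ ?]; exists t].
Qed.

Lemma never_crossesE (R : realType) (r a b : R) :
  never_crosses r a b = \bigcap_(t : nat) ~` [set f | crosses (centered f) r t%:R a b].
Proof. by apply/seteqP; split => f h t; [move=> _|]; exact: h. Qed.

Lemma future_never_crosses (R : realType) (r a b : R) :
  <<s @future_sets R>> (never_crosses r a b).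
Proof.
rewrite never_crossesE; apply: (@bigcapT_measurable _ (g_sigma_algebraType _)) => t.
by apply: (@measurableC _ (g_sigma_algebraType _)); exact: future_crosses.
Qed.

Definition avoids (R : realType) (e z M : R) : set (R -> R) :=
  ~` [set f | exists2 u, dyadic u & M <= u /\ `|centered f u - z| < e].

Lemma future_avoids (R : realType) (e z M : R) : <<s @future_sets R>> (avoids e z M).
Proof.
apply: (@measurableC _ (g_sigma_algebraType _)); apply: g_sigma_dyadic_exists => u du.
have [Mu|Mu] := pselect (M <= u); last first.
  rewrite [X in _ X](_ : _ = set0); last first.
    by apply/seteqP; split => f // -[].
  exact: (@measurable0 _ (g_sigma_algebraType _)).
rewrite [X in _ X](_ : _ = [set f | `|f u - f 0 - z| < e]); last first.
  by apply/seteqP; split => f; [case|].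
exact: (future_coordinate du (measurable_near z e)).
Qed.

Lemma dyadicB (R : realType) (u v : R) : dyadic u -> dyadic v -> v <= u ->
  dyadic (u - v).
Proof.
move=> [N [k ->]] [M [l ->]].
rewrite (dyadic_refine _ k (leq_maxl N M)) (dyadic_refine _ l (leq_maxr N M)).
rewrite ler_pM2r ?invr_gt0 ?exprn_gt0// ler_nat => lk.
by rewrite -mulrBl -natrB//; do 2!eexists.
Qed.

(** * Real-valued probabilities and null events *)

Section prob.
Context (R : realType) (d : measure_display) (T : measurableType d).
Context (P : probability T R).

Definition prob (A : set T) : R := fine (P A).

Lemma probK A : measurable A -> P A = (prob A)%:E.
Proof. by move=> mA; rewrite /prob fineK// fin_num_measure. Qed.

Lemma prob_ge0 A : 0 <= prob A.
Proof. by rewrite /prob fine_ge0. Qed.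

Lemma prob_le_ae A B : measurable A -> measurable B ->
  {ae P, forall w, A w -> B w} -> prob A <= prob B.
Proof.
move=> mA mB [N [mN N0 hN]]; rewrite -lee_fin -!probK//.
rewrite -(measureU0 mB mN N0); apply: le_measure; rewrite ?inE//.
  exact: measurableU.
move=> w Aw; have [Bw|nBw] := pselect (B w); [by left|right].
by apply: hN => /= h; apply: nBw; exact: h.
Qed.

Lemma prob_le A B : measurable A -> measurable B -> A `<=` B -> prob A <= prob B.
Proof. by move=> mA mB AB; apply: prob_le_ae => //; apply: aeW => w; exact: AB. Qed.

Lemma probIC A B : measurable A -> measurable B ->
  prob A = prob (A `&` B) + prob (A `&` ~` B).
Proof.
move=> mA mB.
have mI := measurableI _ _ mA mB; have mC := measurableI _ _ mA (measurableC mB).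
apply: EFin_inj; rewrite EFinD -!probK// -measureU//.
  by rewrite -setIUr setUv setIT.
by rewrite setIACA setICr setI0.
Qed.

Lemma probC A : measurable A -> prob (~` A) = 1 - prob A.
Proof.
move=> mA; apply: EFin_inj; rewrite EFinB -!probK ?probability_setC//.
exact: measurableC.
Qed.

Lemma ae_notin A : measurable A -> prob A = 0 -> {ae P, forall w, ~ A w}.
Proof.
by move=> mA A0; exists A; split => //; [rewrite probK// A0|move=> w /= /contrapT].
Qed.

Lemma ae_prob0 A : measurable A -> {ae P, forall w, ~ A w} -> prob A = 0.
Proof.
move=> mA h; apply/eqP; rewrite eq_le prob_ge0 andbT.
rewrite [leRHS](_ : 0 = prob set0); last by rewrite /prob measure0.
exact: prob_le_ae.
Qed.

Lemma prob_bigcap_cvg (F : (set T)^nat) : (forall n, measurable (F n)) ->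
  (forall n m, (n <= m)%N -> F m `<=` F n) ->
  prob (F n) @[n --> \oo] --> prob (\bigcap_n F n).
Proof.
move=> mF dF; have mI : measurable (\bigcap_n F n) by exact: bigcapT_measurable.
apply: fine_cvg; rewrite fineK ?fin_num_measure//.
apply: nonincreasing_cvg_mu => //.
  by rewrite (le_lt_trans (probability_le1 _ _)) ?ltry.
by move=> n m nm; apply/subsetPset; exact: dF.
Qed.

Lemma ae_nat (Q : nat -> T -> Prop) :
  (forall n, {ae P, forall w, Q n w}) -> {ae P, forall w, forall n, Q n w}.
Proof.
move=> h; apply: (@negligibleS _ _ _ _ (\bigcup_n [set w | ~ Q n w])).
  by move=> w /= /existsNP[n hn]; exists n.
by apply: negligible_bigcup => n; exact: h.
Qed.

End prob.

Lemma past_crosses (R : realType) (s r t a b : R) : t <= s ->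
  <<s past_sets s>> [set f | crosses (centered f) r t a b].
Proof.
move=> ts; apply: g_sigma_crosses => u B du ut; apply: past_coordinate => //.
exact: le_trans ts.
Qed.

(** * Recurrence of every level *)

Section recurrence.
Context (R : realType) (d : measure_display) (T : measurableType d).
Context (P : probability T R) (X : R -> T -> R) (levyX : levy_process P X).

Local Notation Ev A := (path_from X 0 @^-1` A).

Lemma measurable_path s D : dyadic s -> <<s @future_sets R>> D ->
  measurable (path_from X s @^-1` D).
Proof.
move=> ds hD.
by have [] := levy_markov levyX ds (@measurableT _ (g_sigma_algebraType _)) hD.
Qed.

Lemma dyadic0 : dyadic (0 : R).
Proof. exact: (dyadic_nat R 0). Qed.

Lemma measurable_Ev D : <<s @future_sets R>> D -> measurable (Ev D).
Proof. exact: measurable_path dyadic0. Qed.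

Lemma measurable_past_Ev s D : dyadic s -> <<s past_sets s>> D -> measurable (Ev D).
Proof.
move=> ds hD.
by have [] := levy_markov levyX ds hD (@measurableT _ (g_sigma_algebraType _)).
Qed.

Lemma markov_prob s A D : dyadic s -> <<s past_sets s>> A -> <<s @future_sets R>> D ->
  prob P (Ev A `&` path_from X s @^-1` D) = prob P (Ev A) * prob P (Ev D).
Proof.
move=> ds hA hD; have [mA mD mD0 e] := levy_markov levyX ds hA hD.
apply: EFin_inj; rewrite EFinM -!probK//; exact: measurableI.
Qed.

Lemma centered_pathE s w : centered (path_from X s w) = fun u => X (s + u) w - X s w.
Proof. by apply/funext => u; rewrite /centered /path_from addr0. Qed.

Lemma centered_path0E w : X 0 w = 0 -> centered (path_from X 0 w) = X ^~ w.
Proof.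
by move=> X0; rewrite centered_pathE; apply/funext => u; rewrite add0r X0 subr0.
Qed.

Lemma ae_cadlag0 : {ae P, forall w, X 0 w = 0 /\ cadlag (X ^~ w)}.
Proof.
by apply: filterS2 (levy_start levyX) (levy_cadlag levyX) => w; split.
Qed.

(** The dyadic numbers are countable, so [E] would be null if every [V u] were. *)
Lemma exists_dyadic_pos (E : set T) (V : R -> set T) : measurable E ->
  (forall u, dyadic u -> measurable (V u)) -> 0 < prob P E ->
  (forall w, E w -> exists2 u, dyadic u & V u w) ->
  exists2 u, dyadic u & 0 < prob P (V u).
Proof.
move=> mE mV E0 EV; apply: contrapT => hn.
have V0 N k : {ae P, forall w, ~ V (k%:R / 2 ^+ N) w}.
  have dy : dyadic (k%:R / 2 ^+ N : R) by do 2!eexists.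
  apply: ae_notin; first exact: mV.
  apply/eqP; rewrite eq_le prob_ge0 andbT leNgt; apply/negP => h.
  by apply: hn; exists (k%:R / 2 ^+ N).
have := ae_nat (fun N => ae_nat (V0 N)) => h.
suff : prob P E = 0 by move=> e; rewrite e ltxx in E0.
apply: ae_prob0 => //; apply: filterS h => w h /EV[_ [N [k ->]]].
exact: h.
Qed.

(** A possible point in the language of random walks; [revisits] is the matching notion of recurrent
    point. *)
Definition approaches (z : R) : Prop := forall e, 0 < e ->
  exists2 s, dyadic s & 0 < prob P (Ev [set f | `|centered f s - z| < e]).

Definition revisits (z : R) : Prop := forall e M, 0 < e ->
  prob P (Ev (avoids e z M)) = 0.

Lemma future_near s z e : dyadic s ->
  <<s @future_sets R>> [set f | `|centered f s - z| < e].
Proof. by move=> ds; exact: (future_coordinate ds (measurable_near z e)). Qed.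

Lemma revisits_approaches z : revisits z -> approaches z.
Proof.
move=> hz e e0; have mA := measurable_Ev (future_avoids e z 0).
apply: (@exists_dyadic_pos (~` Ev (avoids e z 0))
  (fun u => Ev [set f | `|centered f u - z| < e])).
- exact: measurableC.
- by move=> u du; apply: measurable_Ev; exact: future_near.
- by rewrite probC// hz// subr0.
- by move=> w /= /contrapT[u du [_ ?]]; exists u.
Qed.

(** If the path is near [z] at time [s] and its later increments avoid [y - z], it avoids [y] from
    some time on. The Markov property factors this null event, and the factor for time [s] is
    positive. *)
Lemma revisits_sub y z : approaches z -> revisits y -> revisits (y - z).
Proof.
move=> hz hy e M e0.
have e2 : 0 < e / 2 by rewrite divr_gt0.
have [s ds hs] := hz _ e2.
pose A := [set f : R -> R | `|centered f s - z| < e / 2].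
have pA : <<s past_sets s>> A.
  exact: (past_coordinate ds (lexx s) (measurable_near z (e / 2))).
have fD := future_avoids e (y - z) M.
have := markov_prob ds pA fD.
have mI := measurableI _ _ (measurable_past_Ev ds pA) (measurable_path ds fD).
suff -> : prob P (Ev A `&` path_from X s @^-1` avoids e (y - z) M) = 0.
  by move/esym/eqP; rewrite mulf_eq0 gt_eqF//= => /eqP.
(* [M] may be negative; the maximum with [s] keeps [u - s] nonnegative, hence dyadic. *)
apply/eqP; rewrite eq_le prob_ge0 andbT -[leRHS](hy (e / 2) (Num.max s (s + M)) e2).
apply: prob_le => //; first by apply: measurable_Ev; exact: future_avoids.
move=> w [Aw Dw] [u du]; rewrite ge_max => -[/andP[su sMu] uy]; apply: Dw.
exists (u - s); first exact: dyadicB.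
split; first lra.
have -> : centered (path_from X s w) (u - s) - (y - z) =
    (centered (path_from X 0 w) u - y) - (centered (path_from X 0 w) s - z).
  by rewrite !centered_pathE !add0r subrKC; ring.
apply: le_lt_trans (ler_normB _ _) _.
move: Aw; rewrite /A/= => Aw; lra.
Qed.

(** A zero lower limit gives small values at arbitrarily late times, and right continuity moves them
    to dyadic times. *)
Lemma revisits0 : recurrent P X -> revisits 0.
Proof.
move=> recX e M e0; apply: ae_prob0; first by apply: measurable_Ev; exact: future_avoids.
apply: filterS2 recX ae_cadlag0 => w rw [X0 cw]; apply.
have e2 : 0 < e / 2 by rewrite divr_gt0.
pose V : set R := [set t | Num.max 0 M < t].
have : (ereal_inf [set `|X t w|%:E | t in V] < (e / 2)%:E)%E.
  apply: (@le_lt_trans _ _ 0%E); last by rewrite lte_fin.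
  rewrite -rw limf_einfE; apply: ereal_sup_ubound; exists V => //.
  by exists (Num.max 0 M); split; [exact: num_real|].
move=> /ereal_inf_lt[_ [t Vt <-]]; rewrite lte_fin => Xt.
move: Vt; rewrite /V/= gt_max => /andP[t0 Mt].
have [u [du tu _ Xu]] := cadlag_dyadic cw (ltW t0) e2.
exists u => //; split; first lra.
rewrite centered_path0E// subr0.
by have := ler_normD (X u w - X t w) (X t w); rewrite subrK; lra.
Qed.

Lemma rises_approaches b z : 0 < prob P (Ev (rises b)) -> 0 <= z -> z <= b ->
  approaches z.
Proof.
move=> hb z0 zb e e0.
apply: (exists_dyadic_pos (measurable_Ev (future_rises b)) _ hb).
  by move=> u du; apply: measurable_Ev; exact: future_near.
move=> w [t /crosses_climb[|L [_ _ Lh]]]; first lra.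
by have [u [du _ _ ?]] := Lh z z0 zb e e0; exists u.
Qed.

(** For [0 <= x], the point [- x] comes from [0] by subtracting [n] times the possible point
    [x / n], which lies in [[0, b]] for large [n]. A positive [z] is [0 - (- z)], where [- z] is
    recurrent and hence possible. *)
Lemma revisits_all b z : recurrent P X -> 0 < b -> 0 < prob P (Ev (rises b)) ->
  revisits z.
Proof.
move=> recX b0 hb.
have neg x : 0 <= x -> revisits (- x).
  move=> x0; pose n := (Num.truncn (x / b)).+1; pose y := x / n%:R.
  have n0 : (0 : R) < n%:R by rewrite ltr0n.
  have yb : y <= b.
    rewrite ler_pdivrMr// mulrC -ler_pdivrMr// ltW//.
    exact: truncnS_gt.
  have y0 : 0 <= y by rewrite divr_ge0// ltW.
  have k k' : revisits (- (k'%:R * y)).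
    elim: k' => [|k' ih]; first by rewrite mul0r oppr0; exact: revisits0.
    have -> : - (k'.+1%:R * y) = - (k'%:R * y) - y by rewrite -natr1; ring.
    by apply: revisits_sub => //; exact: rises_approaches yb.
  by rewrite (_ : x = n%:R * y) ?k// /y mulrC divfK// gt_eqF.
have [z0|z0] := leP z 0; first by rewrite -[z]opprK; apply: neg; rewrite oppr_ge0.
rewrite -[z]opprK -[- - z]add0r; apply: revisits_sub; last exact: revisits0.
by apply: revisits_approaches; apply: neg; exact: ltW.
Qed.

(** Since [xi] is almost surely positive, it exceeds some [n.+1%:R^-1] with positive probability; up
    to that level [K] is then a climb. *)
Lemma partial_inverse_rises xi K : partial_right_inverse P X xi K ->
  exists2 b, 0 < b & 0 < prob P (Ev (rises b)).
Proof.
move=> [mxi xi0 _ hK].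
pose U n := [set w | ((n.+1%:R^-1 : R)%:E < xi w)%E].
have mU n : measurable (U n).
  by rewrite -[U n]setTI; exact: emeasurable_fun_o_infty.
have [n Un] : exists n, 0 < prob P (U n).
  apply: contrapT => hn.
  have h n : {ae P, forall w, ~ U n w}.
    apply: ae_notin => //; apply/eqP; rewrite eq_le prob_ge0 andbT leNgt.
    by apply/negP => h; apply: hn; exists n.
  have : prob P setT = 0.
    apply: ae_prob0 => //; apply: filterS2 xi0 (ae_nat h) => w xiw hw _.
    have [n xn] : exists n, ((n.+1%:R^-1 : R)%:E < xi w)%E.
      move: xiw; case: (xi w) => [x| |]//; last by exists 0%N; rewrite ltry.
      rewrite lte_fin => x0; exists (Num.truncn x^-1); rewrite lte_fin.
      by rewrite invf_plt ?posrE// truncnS_gt.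
    exact: (hw n).
  by apply/eqP; rewrite /prob probability_setT/= oner_eq0.
exists n.+1%:R^-1; first by rewrite invr_gt0.
apply: lt_le_trans Un _; apply: prob_le_ae => //.
  by apply: measurable_Ev; exact: future_rises.
apply: filterS2 hK ae_cadlag0 => w [K0 Km KX] [X0 cw] Uw.
have lt x : x <= n.+1%:R^-1 -> (x%:E < xi w)%E.
  by move=> xn; apply: le_lt_trans Uw; rewrite lee_fin.
have cl : climb (X ^~ w) 0 (K n.+1%:R^-1 w) 0 n.+1%:R^-1 (K ^~ w).
  apply: inverse_climb => //.
  - by move=> x x0 /lt; exact: K0.
  - by move=> x y x0 xy /lt; exact: Km.
  - by move=> x x0 /lt; exact: KX.
exists (Num.truncn (K n.+1%:R^-1 w)).+1.
rewrite centered_path0E//; apply: (climb_crosses cw (lexx 0) _ _ cl).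
  by rewrite invr_ge0.
exact: truncnS_gt.
Qed.

End recurrence.

(** The starting value lies in [(z - c, z)], so a rise by [c + c] from it covers [[z, z + c]]. *)
Lemma crosses_from_below (R : realType) (f : R -> R) (s t z c : R) :
  cadlag f -> dyadic s -> 0 < c -> `|f s - (z - c / 2)| < c / 2 ->
  crosses (fun u => f (s + u) - f s) 0 t 0 (c + c) ->
  exists t' : nat, crosses f s t'%:R z (z + c).
Proof.
move=> cf ds c0; rewrite ltr_norml => /andP[fs1 fs2] /crosses_climb[|L].
  by rewrite addr_ge0// ltW.
move=> /(climb_shift ds) cl; exists (Num.truncn (s + t)).+1.
apply: (climb_crosses cf (dyadic_ge0 ds) _ (truncnS_gt _)); last first.
  by apply: climb_sub cl; lra.
by rewrite lerDl ltW.
Qed.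

(** * Almost sure climbs and the full inverse *)

Section full_inverse.
Context (R : realType) (d : measure_display) (T : measurableType d).
Context (P : probability T R) (X : R -> T -> R) (levyX : levy_process P X).

Local Notation Ev A := (path_from X 0 @^-1` A).
Local Notation mEv := (measurable_Ev levyX).

Section restart.
Variables (z c M : R).
Hypotheses (c0 : 0 < c) (dM : dyadic M) (hz : revisits P X (z - c / 2)).

Let time n k : R := M + k%:R / 2 ^+ n.
Let hit n k := [set f : R -> R | `|centered f (time n k) - (z - c / 2)| < c / 2].
(** Intersected with [hit n k], this says that the first visit on the grid has index [k]. *)
Let misses n k := [set f : R -> R | forall i, (i < k)%N -> ~ hit n i f].
Let nev : set (R -> R) := never_crosses M z (z + c).
Let p : R := prob P (Ev (rises (c + c))).

Let dtime n k : dyadic (time n k).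
Proof. by apply: dyadicD => //; do 2!eexists. Qed.

Let past_hit n i k : (i <= k)%N -> <<s past_sets (time n k)>> (hit n i).
Proof.
move=> ik; apply: (past_coordinate (dtime n i) _ (measurable_near _ _)).
by rewrite lerD2l ler_wpM2r ?invr_ge0 ?exprn_ge0// ler_nat.
Qed.

Let misses0 n : misses n 0 = setT.
Proof. by apply/seteqP; split. Qed.

Let missesS n k : misses n k.+1 = misses n k `&` ~` hit n k.
Proof.
apply/seteqP; split => f.
- by move=> h; split => [i ik|]; apply: h => //; exact: ltnW.
- by move=> [h hk] i; rewrite ltnS leq_eqVlt => /predU1P[->//|]; exact: h.
Qed.

Let past_misses n k l : (k <= l)%N -> <<s past_sets (time n l)>> (misses n k).
Proof.
elim: k => [|k ih] kl.
  by rewrite misses0; exact: (@measurableT _ (g_sigma_algebraType _)).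
rewrite missesS; apply: g_sigma_setI; first by apply: ih; exact: ltnW.
by apply: (@measurableC _ (g_sigma_algebraType _)); apply: past_hit; exact: ltnW.
Qed.

Let mhit n k : measurable (Ev (hit n k)).
Proof. exact: (measurable_past_Ev levyX (dtime n k) (past_hit (leqnn k))). Qed.

Let mmisses n k : measurable (Ev (misses n k)).
Proof. exact: (measurable_past_Ev levyX (dtime n k) (past_misses (leqnn k))). Qed.

Let mnev : measurable (Ev nev).
Proof. by apply: mEv; exact: future_never_crosses. Qed.

Let p_le1 : p <= 1.
Proof.
rewrite -subr_ge0 -probC; first exact: prob_ge0.
by apply: mEv; exact: future_rises.
Qed.

(** The indices below [n * 2 ^ n] cover [[M, M + n)] with mesh [2 ^- n]. The events decrease, and on
    their intersection no dyadic time from [M] on visits the interval, which [hz] makes null. *)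
Let misses_cvg0 : prob P (Ev (misses n (n * 2 ^ n))) @[n --> \oo] --> (0 : R).
Proof.
pose F n := Ev (misses n (n * 2 ^ n)).
have mF n : measurable (F n) by exact: mmisses.
have I0 : prob P (\bigcap_n F n) = 0.
  apply/eqP; rewrite eq_le prob_ge0 andbT.
  have c2 : 0 < c / 2 by rewrite divr_gt0.
  rewrite -[leRHS](hz M c2); apply: prob_le; first exact: bigcapT_measurable.
    by apply: mEv; exact: future_avoids.
  move=> w hw [u du [Mu uz]].
  have [N [k uk]] := dyadicB du dM Mu.
  (* Fine enough to contain [u], and larger than [k] so that the index of [u] stays below
     [n * 2 ^ n]. *)
  pose n := maxn N k.+1.
  apply: (hw n I (k * 2 ^ (n - N))%N) => /=.
  - rewrite (@leq_ltn_trans (k * 2 ^ n))// ?leq_mul// ?leq_pexp2l ?leq_subr//.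
    by rewrite ltn_pmul2r ?expn_gt0// /n leq_max leqnn orbT.
  - by rewrite /hit /time/= -dyadic_refine ?leq_maxl// -uk subrKC.
rewrite -[X in _ --> X]I0; apply: prob_bigcap_cvg => // n m nm w hw k kn.
have -> : hit n k = hit m (k * 2 ^ (m - n)) by rewrite /hit /time -dyadic_refine.
apply: hw; apply: (@leq_trans (n * 2 ^ n * 2 ^ (m - n))).
  by rewrite ltn_pmul2r// expn_gt0.
by rewrite -mulnA -expnD subnKC// leq_pmul2r// expn_gt0.
Qed.

(** Split on a visit at index [k]. After a visit, [nev] excludes a rise by [c + c], which the Markov
    property charges with the factor [1 - p]; without a visit the event passes to index [k.+1]. *)
Let step A n k : <<s past_sets (time n k)>> A ->
  prob P (Ev (A `&` misses n k `&` nev)) <=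
  (1 - p) * (prob P (Ev (A `&` misses n k)) - prob P (Ev (A `&` misses n k.+1)))
  + prob P (Ev (A `&` misses n k.+1 `&` nev)).
Proof.
move=> pA; set Q := A `&` misses n k.
have pQ : <<s past_sets (time n k)>> Q by apply: g_sigma_setI => //; exact: past_misses.
have mQ : measurable (Ev Q) by exact: (measurable_past_Ev levyX (dtime n k)).
have QS : A `&` misses n k.+1 = Q `&` ~` hit n k by rewrite missesS setIA.
have mQn : measurable (Ev Q `&` Ev nev) by exact: measurableI.
have -> : prob P (Ev Q) - prob P (Ev (A `&` misses n k.+1)) = prob P (Ev (Q `&` hit n k)).
  by rewrite (probIC P mQ (mhit n k)) QS addrK.
have -> : prob P (Ev (Q `&` nev)) =
    prob P (Ev (Q `&` nev `&` hit n k)) + prob P (Ev (A `&` misses n k.+1 `&` nev)).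
  rewrite [LHS](probIC P mQn (mhit n k)); congr (_ + prob P _).
  by rewrite QS; apply/seteqP; split => w [[? ?] ?].
rewrite lerD2r.
have fr := @future_rises R (c + c).
have fnr : <<s @future_sets R>> (~` rises (c + c)).
  exact: (@measurableC _ (g_sigma_algebraType _)).
have pQh : <<s past_sets (time n k)>> (Q `&` hit n k).
  by apply: g_sigma_setI => //; exact: past_hit.
have e : prob P (Ev (~` rises (c + c))) = 1 - p by rewrite -probC//; exact: mEv.
rewrite mulrC -e -(markov_prob levyX (dtime n k) pQh fnr).
apply: prob_le_ae; first exact: (measurableI _ _ mQn (mhit n k)).
  apply: measurableI; first exact: (measurable_past_Ev levyX (dtime n k)).
  exact: (measurable_path levyX (dtime n k) fnr).
apply: filterS (ae_cadlag0 levyX) => w [X0 cw] [[Qw nw] hw]; split => // -[t].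
rewrite centered_pathE => /(crosses_from_below cw (dtime n k) c0).
move: hw nw; rewrite /hit /nev /never_crosses/= centered_path0E// => hw nw.
move=> /(_ z hw)[t' ct']; apply: (nw t'); apply: crosses_le ct' => //.
by rewrite /time lerDl divr_ge0// exprn_ge0.
Qed.

(* The process is stopped at its first visit, on a grid of mesh [2^-n], of the
   interval [(z - c, z)] after time [M]; a climb by [2c] from there sweeps
   [z, z + c]. *)
Lemma never_crosses_past A :
  (forall s, dyadic s -> M <= s -> <<s past_sets s>> A) ->
  prob P (Ev (A `&` nev)) <= (1 - p) * prob P (Ev A).
Proof.
move=> pA.
have pAt n k : <<s past_sets (time n k)>> A.
  by apply: pA => //; rewrite /time lerDl divr_ge0// exprn_ge0.
have mA : measurable (Ev A) by exact: (measurable_past_Ev levyX (dtime 0 0)).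
(* Summing [step] over the first [k] indices, the first-visit probabilities telescope. *)
have bound n k : prob P (Ev (A `&` nev)) <=
    (1 - p) * (prob P (Ev A) - prob P (Ev (A `&` misses n k)))
    + prob P (Ev (A `&` misses n k `&` nev)).
  elim: k => [|k ih].
    by rewrite misses0 setIT subrr mulr0 add0r.
  apply: le_trans ih _.
  have := step (pAt n k).
  rewrite !mulrBr; lra.
(* The event of no visit on the grid is kept as an error term that vanishes as [n] grows; [p <= 1]
   allows the subtracted term to be dropped. *)
have lim0 n : prob P (Ev (A `&` nev)) <=
    (1 - p) * prob P (Ev A) + prob P (Ev (misses n (n * 2 ^ n))).
  apply: le_trans (bound n (n * 2 ^ n)%N) _.
  set k := (n * 2 ^ n)%N.
  have mAm : measurable (Ev (A `&` misses n k)) by exact: (measurableI _ _ mA (mmisses n k)).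
  have : prob P (Ev (A `&` misses n k `&` nev)) <= prob P (Ev (misses n k)).
    by apply: prob_le => //; [exact: (measurableI _ _ mAm mnev)|move=> w [[]]].
  have : 0 <= (1 - p) * prob P (Ev (A `&` misses n k)).
    by rewrite mulr_ge0 ?prob_ge0// subr_ge0.
  rewrite mulrBr; lra.
rewrite -[leRHS]addr0.
apply: (@ler_cvg_to _ \oo _ _ (fun=> prob P (Ev (A `&` nev)))
  (fun n => (1 - p) * prob P (Ev A) + prob P (Ev (misses n (n * 2 ^ n)))));
  [exact: cvg_cst| |by near=> n; exact: lim0].
by apply: cvgD; [exact: cvg_cst|exact: misses_cvg0].
Unshelve. all: by end_near.
Qed.

End restart.

(* Decreasing limit of the bound on the events that no crossing occurs in
   [[r, n]], which belong to the past of [n]. *)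
Lemma never_crosses_prob0 (z c : R) (r : nat) : 0 < c ->
  revisits P X (z - c / 2) -> 0 < prob P (Ev (rises (c + c))) ->
  prob P (Ev (never_crosses r%:R z (z + c))) = 0.
Proof.
move=> c0 hz p0; set p := prob P _ in p0; set N := never_crosses _ _ _.
pose A n : set (R -> R) := ~` [set f | crosses (centered f) r%:R n%:R z (z + c)].
have mA n : measurable (Ev (A n)).
  apply: (mEv); apply: (@measurableC _ (g_sigma_algebraType _)); exact: future_crosses.
have mN r' : measurable (Ev (never_crosses r' z (z + c))).
  by apply: (mEv); exact: future_never_crosses.
have cvgA : prob P (Ev (A n)) @[n --> \oo] --> prob P (Ev N).
  have -> : Ev N = \bigcap_n Ev (A n).
    by apply/seteqP; split => w h n; [move=> _|]; exact: h.
  apply: prob_bigcap_cvg => // n m nm w /= hw cn; apply: hw.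
  by apply: crosses_le cn => //; rewrite ler_nat.
(* For [n >= r], [N] lies in [A n] and in the event of no crossing after [n]. The one-restart bound
   with [M = n] applies, and then [n] tends to infinity. *)
have key : prob P (Ev N) <= (1 - p) * prob P (Ev N).
  apply: (@ler_cvg_to _ \oo _ _ (fun=> prob P (Ev N)) (fun n => (1 - p) * prob P (Ev (A n))));
    [exact: cvg_cst|by apply: cvgM => //; exact: cvg_cst|].
  exists r => // n /= rn.
  apply: le_trans (never_crosses_past c0 (dyadic_nat R n) hz _); last first.
    move=> s ds ns; apply: (@measurableC _ (g_sigma_algebraType _)).
    exact: past_crosses.
  apply: prob_le; [exact: mN|exact: (measurableI _ _ (mA n) (mN n%:R))|].
  move=> w Nw; split; first exact: Nw.
  move=> t ct; apply: (Nw t); apply: crosses_le ct => //.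
  by rewrite ler_nat.
apply/eqP; rewrite eq_le prob_ge0 andbT.
by rewrite -(pmulr_rle0 _ p0); lra.
Qed.

(** Countably many null events, indexed by the level [j] and an integer starting time [r], are
    discarded. Each climb by [c] then starts at an integer after the end of the previous one. *)
Lemma ae_climbs_all b : recurrent P X -> 0 < b -> 0 < prob P (Ev (rises b)) ->
  {ae P, forall w, forall y, 0 <= y -> exists t, crosses (X ^~ w) 0 t 0 y}.
Proof.
move=> recX b0 hb; pose c := b / 2.
have c0 : 0 < c by rewrite divr_gt0.
have cc : c + c = b by rewrite /c; lra.
have h j r : {ae P, forall w, ~ Ev (never_crosses r%:R (j%:R * c) (j%:R * c + c)) w}.
  apply: ae_notin; first by apply: mEv; exact: future_never_crosses.
  apply: never_crosses_prob0 => //; last by rewrite cc.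
  exact: (revisits_all levyX _ recX b0).
apply: filterS2 (ae_cadlag0 levyX) (ae_nat (fun j => ae_nat (h j))) => w [X0 cw] hw y y0.
have climbs j : exists t L, climb (X ^~ w) 0 t 0 (j%:R * c) L.
  elim: j => [|j [t [L cl]]].
    (* The climb of the single level [0] stays at time [0], where the path starts. *)
    exists 0, (fun=> 0); rewrite mul0r.
    apply: (inverse_climb (K := fun=> 0)) => // x x0 xle.
    by rewrite X0; lra.
  pose r := (Num.truncn t).+1.
  have /existsNP[t' /contrapT] := hw j r.
  rewrite centered_path0E// => /crosses_climb[|L' cl']; first by rewrite lerDl ltW.
  exists t'%:R; rewrite (_ : j.+1%:R * c = j%:R * c + c); last by rewrite -natr1; ring.
  apply: (climb_cat _ _ _ cl cl').
  - by rewrite mulr_ge0// ltW.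
  - by rewrite lerDl ltW.
  - by rewrite ltW// truncnS_gt.
have [t [L cl]] := climbs (Num.truncn (y / c)).+1.
exists (t + 1); apply: (climb_crosses cw (lexx 0) y0 (t := t) (L := L)); first lra.
apply: climb_sub cl => //.
by rewrite -ler_pdivrMr// ltW// truncnS_gt.
Qed.

(** The infimum is below [c] when some dyadic [u < c] belongs to the set, or when the set is empty
    and [0 < c], because [inf set0 = 0]. *)
Lemma measurable_first_climb x :
  measurable_fun setT (fun w => first_climb (centered (path_from X 0 w)) x).
Proof.
apply: (measurability _ (RGenInftyO.measurableE R)) => _ [_ [c ->] <-]; rewrite setTI.
pose E u : set (R -> R) :=
  [set f | exists j : nat, crosses (centered f) 0 u 0 (x + j.+1%:R^-1)].
have fE u : <<s @future_sets R>> (E u).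
  rewrite (_ : E u = \bigcup_j [set f | crosses (centered f) 0 u 0 (x + j.+1%:R^-1)]).
    apply: (@bigcupT_measurable _ (g_sigma_algebraType _)) => j; exact: future_crosses.
  by apply/seteqP; split => f; [move=> [j ?]; exists j|move=> [j _ ?]; exists j].
pose V := [set f | exists2 u : R, dyadic u & (E u `&` [set _ | u < c]) f].
pose U := [set f | exists2 u : R, dyadic u & E u f].
have fset (b : Prop) : <<s @future_sets R>> [set _ | b].
  have [hb|hb] := pselect b.
    rewrite (_ : [set _ | _] = setT); last by apply/seteqP; split.
    exact: (@measurableT _ (g_sigma_algebraType _)).
  rewrite (_ : [set _ | _] = set0); last by apply/seteqP; split.
  exact: (@measurable0 _ (g_sigma_algebraType _)).
have fU : <<s @future_sets R>> U by apply: g_sigma_dyadic_exists.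
have fV : <<s @future_sets R>> V.
  by apply: g_sigma_dyadic_exists => u _; exact: g_sigma_setI.
rewrite [X in measurable X](_ : _ = Ev (V `|` (~` U `&` [set _ | 0 < c]))).
  apply: mEv; apply: (@measurableU _ (g_sigma_algebraType _)) => //.
  by apply: g_sigma_setI => //; exact: (@measurableC _ (g_sigma_algebraType _)).
pose S (f : R -> R) := [set t : R | dyadic t /\ E t f].
have SE f : first_climb (centered f) x = inf (S f) by [].
apply/seteqP; split => w /=; rewrite in_itv/=; move: (path_from X 0 w) => f.
- move=> fc; have [[u du Eu]|nU] := pselect (U f).
    left; have iS : has_inf (S f).
      by split; [exists u|exists 0 => t [/dyadic_ge0]].
    have [|t [dt Et] tc] := @inf_adherent _ (S f) (c - inf (S f)) _ iS.
      by rewrite subr_gt0 -SE.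
    by exists t => //; split => //=; rewrite addrC subrK in tc.
  right; split => //; apply: le_lt_trans fc; rewrite SE (_ : S f = set0) ?inf0//.
  by apply/seteqP; split => // t [dt Et]; apply: nU; exists t.
- rewrite SE => -[[u du [Eu uc]]|[nU c0]].
    apply: le_lt_trans uc; apply: ge_inf => //.
    by exists 0 => t [/dyadic_ge0].
  rewrite (_ : S f = set0) ?inf0//.
  by apply/seteqP; split => // t [dt Et]; apply: nU; exists t.
Qed.

End full_inverse.

Theorem corollary4 (R : realType) (d : measure_display) (T : measurableType d)
    (P : probability T R) (X : R -> T -> R)
    (levyX : levy_process P X) (recX : recurrent P X) :
  (exists (xi : T -> \bar R) (K : R -> T -> R),
     partial_right_inverse P X xi K) <->
  (exists K : R -> T -> R, full_right_inverse P X K).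
Proof.
split=> [[xi [K /(partial_inverse_rises levyX)[b b0 rb]]]|[K [mK hK]]]; last first.
  exists (fun=> +oo%E), K; split.
  - exact: measurable_cst.
  - by apply: aeW => w; exact: ltry.
  - move=> x x0; rewrite (_ : [set _ | _] = setT); first exact: mK.
    by apply/seteqP; split => // w _ /=; exact: ltry.
  - apply: filterS hK => w [K0 Km KX].
    by split=> [x x0 _|x y x0 xy _|x x0 _]; [exact: K0|exact: Km|exact: KX].
(* The path is centered because its measurability lemma is stated for increments; almost surely it
   is the path of [X] itself. *)
exists (fun x w => first_climb (centered (path_from X 0 w)) x); split.
  by move=> x _; exact: (measurable_first_climb levyX).
apply: filterS2 (ae_cadlag0 levyX) (ae_climbs_all levyX recX b0 rb) => w [X0 cw] hw.
by rewrite centered_path0E//; exact: first_climb_inverse.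
Qed.
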